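(* Let $\mathbf{A}$ be an involutive monoidal category, $\mathbf{D}$ a discrete category, $F\colon\mathbf{D}\to\mathbf{A}$ a functor, and let $\mathrm{cp}=\big(\mathrm{cp}_X\colon\overline{F(X)}\otimes F(X)\to\Omega\big)_{X\in\mathbf{D}}$ be a comparison cluster in $\mathbf{A}$. Then there is a category $\mathrm{TRel}(\mathbf{A},\mathrm{cp})$ whose objects are the indices $X\in\mathbf{D}$, whose morphisms $X\to Y$ are the tame relations $r\colon\overline{F(X)}\otimes F(Y)\to\Omega$, with the comparison relation $\mathrm{cp}_X$ as identity map on $X$, and with composition $s\bullet r = s\circ(\overline{r_*}\otimes\mathrm{id})$ for $r\colon X\to Y$, $s\colon Y\to Z$. If moreover $\mathbf{A}$ is an involutive symmetric monoidal category and the comparison cluster is symmetric, then $\mathrm{TRel}(\mathbf{A},\mathrm{cp})$ is a dagger category, with dagger of $r\colon X\to Y$ given by $r^\dagger=\mathrm{cp}_X\circ(\overline{r^*}\otimes\mathrm{id})\colon\overline{F(Y)}\otimes F(X)\to\Omega$.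
   Context: Involutive category: a category $\mathbf{A}$ with a functor $\overline{(-)}\colon\mathbf{A}\to\mathbf{A}$ and a natural isomorphism $\iota_X\colon X\to\overline{\overline{X}}$ with $\overline{\iota_X}=\iota_{\overline{X}}$. A self-conjugate is an object $X$ with a map $j\colon\overline{X}\to X$ such that $j\circ\overline{j}=\iota_X^{-1}$ (then $j$ is an isomorphism). Involutive (symmetric) monoidal category: $\mathbf{A}$ is both involutive and (symmetric) monoidal, $\overline{(-)}$ is a (symmetric) monoidal functor via $\zeta\colon I\to\overline{I}$ and natural $\xi\colon\overline{X}\otimes\overline{Y}\to\overline{X\otimes Y}$ (commuting with the monoidal isomorphisms), and $\iota$ is a monoidal natural transformation: $\overline{\zeta}\circ\zeta=\iota_I$ and $\overline{\xi}\circ\xi\circ(\iota_X\otimes\iota_Y)=\iota_{X\otimes Y}$. (Then $\zeta,\xi$ are isomorphisms.) In the symmetric case, with symmetry $\gamma$, the twist is $\tau=\gamma\circ(\iota_X^{-1}\otimes\mathrm{id})\circ\xi^{-1}\colon\overline{\overline{X}\otimes Y}\to\overline{Y}\otimes X$. Comparison relation: a map $\mathrm{cp}\colon\overline{X}\otimes X\to\Omega$ such that $f=g$ follows from $\mathrm{cp}\circ(\mathrm{id}\otimes f)=\mathrm{cp}\circ(\mathrm{id}\otimes g)$, for parallel $f,g$ into $X$, and $f=g$ also follows from $\mathrm{cp}\circ(f\otimes\mathrm{id})=\mathrm{cp}\circ(g\otimes\mathrm{id})$, for parallel $f,g$ into $\overline{X}$. In the symmetric monoidal setting, given a self-conjugate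 structure $j\colon\overline{\Omega}\to\Omega$, it is symmetric if $\mathrm{cp}\circ\tau=j\circ\overline{\mathrm{cp}}\colon\overline{\overline{X}\otimes X}\to\Omega$. Comparison cluster: a family of comparison relations $\mathrm{cp}_X\colon\overline{F(X)}\otimes F(X)\to\Omega$, indexed by the objects $X$ of a discrete category $\mathbf{D}$, with $F\colon\mathbf{D}\to\mathbf{A}$ a functor and $\Omega$ a shared target; it is symmetric if every $\mathrm{cp}_X$ is. A relation is a map $r\colon\overline{F(X)}\otimes F(Y)\to\Omega$. It is tame if there are (necessarily unique) maps $r_*\colon F(X)\to F(Y)$ and $r^*\colon F(Y)\to F(X)$ in $\mathbf{A}$ with $\mathrm{cp}_Y\circ(\overline{r_*}\otimes\mathrm{id})=r=\mathrm{cp}_X\circ(\mathrm{id}\otimes r^* )$. A dagger category is a category with an identity-on-objects contravariant functor $(-)^\dagger$ satisfying $r^{\dagger\dagger}=r$. *)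

(* Defs.v *)
From Stdlib Require Import ClassicalEpsilon.

Set Implicit Arguments.
Unset Strict Implicit.
Unset Printing Implicit Defensive.

Declare Scope cat_scope.
Delimit Scope cat_scope with cat.
Open Scope cat_scope.

(* The laws are separated from the objects and maps, so that one can say that
   given objects and maps form a category. *)
Record CategoryOn (Ob : Type) (Hom : Ob -> Ob -> Type) : Type := {
  idm : forall X, Hom X X;
  comp : forall X Y Z, Hom Y Z -> Hom X Y -> Hom X Z;
  comp_idl : forall X Y (f : Hom X Y), comp (idm Y) f = f;
  comp_idr : forall X Y (f : Hom X Y), comp f (idm X) = f;
  comp_assoc : forall W X Y Z (h : Hom Y Z) (g : Hom X Y) (f : Hom W X),
    comp h (comp g f) = comp (comp h g) f
}.

Record Category : Type := Cat {
  ob :> Type;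
  hom : ob -> ob -> Type;
  cat_on : CategoryOn hom
}.

Definition id {C : Category} (X : C) : hom X X := idm (cat_on C) X.

Notation "g ∘ f" := (comp (cat_on _) g f)
  (at level 40, left associativity) : cat_scope.

Inductive is_identity (C : Category) : forall X Y : C, hom X Y -> Prop :=
  is_identity_id : forall X : C, is_identity (id X).

Definition discrete (C : Category) : Prop :=
  forall (X Y : C) (f : hom X Y), is_identity f.

Record Iso (C : Category) (X Y : C) : Type := {
  fwd :> hom X Y;
  inv : hom Y X;
  inv_fwd : inv ∘ fwd = id X;
  fwd_inv : fwd ∘ inv = id Y
}.

Record Functor (C D : Category) : Type := {
  fob :> C -> D;
  fmap : forall X Y : C, hom X Y -> hom (fob X) (fob Y);
  fmap_id : forall X : C, fmap (id X) = id (fob X);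
  fmap_comp : forall (X Y Z : C) (g : hom Y Z) (f : hom X Y),
    fmap (g ∘ f) = fmap g ∘ fmap f
}.

Record Dagger (C : Category) : Type := {
  dag :> forall X Y : C, hom X Y -> hom Y X;
  dag_id : forall X : C, dag (id X) = id X;
  dag_comp : forall (X Y Z : C) (g : hom Y Z) (f : hom X Y),
    dag (g ∘ f) = dag f ∘ dag g;
  dag_dag : forall (X Y : C) (f : hom X Y), dag (dag f) = f
}.

Record MonCat : Type := {
  mon_cat :> Category;
  tensor : mon_cat -> mon_cat -> mon_cat;
  tmap : forall X X' Y Y' : mon_cat,
    hom X X' -> hom Y Y' -> hom (tensor X Y) (tensor X' Y');
  tmap_id : forall X Y : mon_cat, tmap (id X) (id Y) = id (tensor X Y);
  tmap_comp : forall (X X' X'' Y Y' Y'' : mon_cat)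
    (g : hom X' X'') (f : hom X X') (k : hom Y' Y'') (h : hom Y Y'),
    tmap (g ∘ f) (k ∘ h) = tmap g k ∘ tmap f h;
  unit : mon_cat;
  assoc : forall X Y Z : mon_cat,
    Iso (tensor (tensor X Y) Z) (tensor X (tensor Y Z));
  lunit : forall X : mon_cat, Iso (tensor unit X) X;
  runit : forall X : mon_cat, Iso (tensor X unit) X;
  assoc_nat : forall (X X' Y Y' Z Z' : mon_cat)
    (f : hom X X') (g : hom Y Y') (h : hom Z Z'),
    assoc X' Y' Z' ∘ tmap (tmap f g) h = tmap f (tmap g h) ∘ assoc X Y Z;
  lunit_nat : forall (X Y : mon_cat) (f : hom X Y),
    lunit Y ∘ tmap (id unit) f = f ∘ lunit X;
  runit_nat : forall (X Y : mon_cat) (f : hom X Y),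
    runit Y ∘ tmap f (id unit) = f ∘ runit X;
  triangle : forall X Y : mon_cat,
    tmap (id X) (lunit Y) ∘ assoc X unit Y = tmap (runit X) (id Y);
  pentagon : forall W X Y Z : mon_cat,
    tmap (id W) (assoc X Y Z) ∘ assoc W (tensor X Y) Z
      ∘ tmap (assoc W X Y) (id Z)
    = assoc W X (tensor Y Z) ∘ assoc (tensor W X) Y Z
}.

Notation "X ⊗ Y" := (tensor X Y)
  (at level 38, left associativity) : cat_scope.
Notation "f ⊗₁ g" := (tmap f g)
  (at level 38, left associativity) : cat_scope.

Record Symmetry (M : MonCat) : Type := {
  gamma : forall X Y : M, hom (X ⊗ Y) (Y ⊗ X);
  gamma_nat : forall (X X' Y Y' : M) (f : hom X X') (g : hom Y Y'),
    gamma X' Y' ∘ (f ⊗₁ g) = (g ⊗₁ f) ∘ gamma X Y;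
  gamma_gamma : forall X Y : M, gamma Y X ∘ gamma X Y = id (X ⊗ Y);
  hexagon : forall X Y Z : M,
    assoc Y Z X ∘ gamma X (Y ⊗ Z) ∘ assoc X Y Z
    = (id Y ⊗₁ gamma X Z) ∘ assoc Y X Z ∘ (gamma X Y ⊗₁ id Z)
}.

(* Lax monoidal structure: [zeta] and [xi] are not assumed invertible;
   for the conjugation functor this follows, see [xi_iso]. *)
Record MonoidalFunctor (M N : MonCat) (F : Functor M N) : Type := {
  zeta : hom (unit N) (F (unit M));
  xi : forall X Y : M, hom (F X ⊗ F Y) (F (X ⊗ Y));
  xi_nat : forall (X X' Y Y' : M) (f : hom X X') (g : hom Y Y'),
    xi X' Y' ∘ (fmap F f ⊗₁ fmap F g) = fmap F (f ⊗₁ g) ∘ xi X Y;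
  xi_assoc : forall X Y Z : M,
    fmap F (assoc X Y Z) ∘ xi (X ⊗ Y) Z ∘ (xi X Y ⊗₁ id (F Z))
    = xi X (Y ⊗ Z) ∘ (id (F X) ⊗₁ xi Y Z) ∘ assoc (F X) (F Y) (F Z);
  xi_lunit : forall X : M,
    fmap F (lunit X) ∘ xi (unit M) X ∘ (zeta ⊗₁ id (F X)) = lunit (F X);
  xi_runit : forall X : M,
    fmap F (runit X) ∘ xi X (unit M) ∘ (id (F X) ⊗₁ zeta) = runit (F X)
}.

Record Involution (C : Category) : Type := {
  inv_bar : Functor C C;
  inv_iota : forall X : C, Iso X (inv_bar (inv_bar X));
  inv_iota_nat : forall (X Y : C) (f : hom X Y),
    inv_iota Y ∘ f = fmap inv_bar (fmap inv_bar f) ∘ inv_iota X;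
  inv_bar_iota : forall X : C,
    fmap inv_bar (inv_iota X) = inv_iota (inv_bar X)
}.

Record SelfConjugate (C : Category) (V : Involution C) (X : C) : Type := {
  sc_map :> hom (inv_bar V X) X;
  sc_law : sc_map ∘ fmap (inv_bar V) sc_map = inv (inv_iota V X)
}.

Record InvMonCat : Type := {
  im_mon :> MonCat;
  im_inv : Involution im_mon;
  im_barM : MonoidalFunctor (inv_bar im_inv);
  iota_zeta :
    fmap (inv_bar im_inv) (zeta im_barM) ∘ zeta im_barM
    = inv_iota im_inv (unit im_mon);
  iota_xi : forall X Y : im_mon,
    fmap (inv_bar im_inv) (xi im_barM X Y)
      ∘ xi im_barM (inv_bar im_inv X) (inv_bar im_inv Y)
      ∘ (inv_iota im_inv X ⊗₁ inv_iota im_inv Y)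
    = inv_iota im_inv (X ⊗ Y)
}.

Definition bar {A : InvMonCat} (X : A) : A := inv_bar (im_inv A) X.
Definition barmap {A : InvMonCat} {X Y : A} (f : hom X Y) :
  hom (bar X) (bar Y) := fmap (inv_bar (im_inv A)) f.
Definition iota {A : InvMonCat} (X : A) : Iso X (bar (bar X)) :=
  inv_iota (im_inv A) X.

Section XiIso.

Variables (A : InvMonCat) (X Y : A).

Let xiA (U V : A) : hom (bar U ⊗ bar V) (bar (U ⊗ V)) := xi (im_barM A) U V.

Definition xi_inv : hom (bar (X ⊗ Y)) (bar X ⊗ bar Y) :=
  inv (iota (bar X ⊗ bar Y)) ∘ barmap (xiA (bar X) (bar Y))
    ∘ barmap (iota X ⊗₁ iota Y).

Lemma xi_inv_xi : xi_inv ∘ xiA X Y = id (bar X ⊗ bar Y).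
Proof.
pose proof (iota_xi (bar X) (bar Y)) as H; rewrite <- comp_assoc in H.
unfold xi_inv, xiA, barmap, bar, iota in *.
rewrite <- !comp_assoc, <- xi_nat, !inv_bar_iota, H; apply inv_fwd.
Qed.

Lemma xi_xi_inv : xiA X Y ∘ xi_inv = id (bar (X ⊗ Y)).
Proof.
assert (N : forall (U V : A) (f : hom U V),
  f ∘ inv (iota U) = inv (iota V) ∘ barmap (barmap f)).
{ intros U V f; pose proof (inv_iota_nat (im_inv A) f) as H.
  apply (f_equal (fun h => inv (iota V) ∘ h ∘ inv (iota U))) in H.
  unfold iota in *.
  rewrite (comp_assoc (cat_on A) _ _ f), inv_fwd, <- !comp_assoc, fwd_inv in H.
  unfold id in H; rewrite comp_idl, comp_idr in H; exact H. }
unfold xi_inv; rewrite !comp_assoc, N, <- !comp_assoc.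
unfold barmap, bar; rewrite <- !fmap_comp, comp_assoc.
unfold xiA, iota, bar in *; rewrite iota_xi, inv_bar_iota; apply inv_fwd.
Qed.

Definition xi_iso : Iso (bar X ⊗ bar Y) (bar (X ⊗ Y)) :=
  {| fwd := xiA X Y; inv := xi_inv;
     inv_fwd := xi_inv_xi; fwd_inv := xi_xi_inv |}.

End XiIso.

(* What an involutive monoidal category needs in addition in order to be an
   involutive symmetric monoidal category. *)
Record InvSymmetry (A : InvMonCat) : Type := {
  is_sym :> Symmetry A;
  bar_gamma : forall X Y : A,
    barmap (gamma is_sym X Y) ∘ xi_iso X Y
    = xi_iso Y X ∘ gamma is_sym (bar X) (bar Y)
}.

Definition twist (A : InvMonCat) (S : InvSymmetry A) (X Y : A) :
  hom (bar (bar X ⊗ Y)) (bar Y ⊗ X) :=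
  gamma S X (bar Y) ∘ (inv (iota X) ⊗₁ id (bar Y)) ∘ inv (xi_iso (bar X) Y).

Record is_comparison (A : InvMonCat) (Omega X : A)
    (cp : hom (bar X ⊗ X) Omega) : Prop := {
  comparison_r : forall (Z : A) (f g : hom Z X),
    cp ∘ (id (bar X) ⊗₁ f) = cp ∘ (id (bar X) ⊗₁ g) -> f = g;
  comparison_l : forall (Z : A) (f g : hom Z (bar X)),
    cp ∘ (f ⊗₁ id X) = cp ∘ (g ⊗₁ id X) -> f = g
}.

Definition symmetric_comparison (A : InvMonCat) (S : InvSymmetry A)
    (Omega X : A) (j : SelfConjugate (im_inv A) Omega)
    (cp : hom (bar X ⊗ X) Omega) : Prop :=
  cp ∘ twist S X X = j ∘ barmap cp.

Record Cluster (A : InvMonCat) (D : Category) (F : Functor D A) (Omega : A) :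
    Type := {
  cluster_map :> forall X : D, hom (bar (F X) ⊗ F X) Omega;
  cluster_comparison : forall X : D, is_comparison (cluster_map X)
}.

Definition symmetric_cluster (A : InvMonCat) (S : InvSymmetry A) (D : Category)
    (F : Functor D A) (Omega : A) (j : SelfConjugate (im_inv A) Omega)
    (cp : Cluster F Omega) : Prop :=
  forall X : D, symmetric_comparison S j (cp X).

Section Tame.

Variables (A : InvMonCat) (D : Category) (F : Functor D A) (Omega : A)
  (cp : Cluster F Omega).

Definition relation (X Y : D) : Type := hom (bar (F X) ⊗ F Y) Omega.

Definition is_lower_star (X Y : D) (r : relation X Y) (f : hom (F X) (F Y)) :
  Prop := cp Y ∘ (barmap f ⊗₁ id (F Y)) = r.

Definition is_upper_star (X Y : D) (r : relation X Y) (g : hom (F Y) (F X)) :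
  Prop := r = cp X ∘ (id (bar (F X)) ⊗₁ g).

Definition tame (X Y : D) (r : relation X Y) : Prop :=
  (exists f, is_lower_star r f) /\ (exists g, is_upper_star r g).

(* The stars are not part of the data: two tame relations are equal as soon as
   the underlying relations are, by proof irrelevance. *)
Record TameRel (X Y : D) : Type := {
  rel : relation X Y;
  rel_tame : tame rel
}.

(* [lower_star r] is r_* and [upper_star r] is r^*; see [lower_star_unique] and
   [upper_star_unique] for the independence of the choice. *)
Definition lower_star (X Y : D) (r : TameRel X Y) : hom (F X) (F Y) :=
  proj1_sig (constructive_indefinite_description _ (proj1 (rel_tame r))).

Definition upper_star (X Y : D) (r : TameRel X Y) : hom (F Y) (F X) :=
  proj1_sig (constructive_indefinite_description _ (proj2 (rel_tame r))).

Lemma lower_starP (X Y : D) (r : TameRel X Y) :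
  is_lower_star (rel r) (lower_star r).
Proof. exact (proj2_sig (constructive_indefinite_description _ _)). Qed.

Lemma upper_starP (X Y : D) (r : TameRel X Y) :
  is_upper_star (rel r) (upper_star r).
Proof. exact (proj2_sig (constructive_indefinite_description _ _)). Qed.

Lemma lower_star_unique (X Y : D) (r : relation X Y) (f g : hom (F X) (F Y)) :
  is_lower_star r f -> is_lower_star r g -> f = g.
Proof.
intros Hf Hg.
assert (E : barmap f = barmap g).
{ apply (comparison_l (cluster_comparison cp Y)).
  exact (eq_trans Hf (eq_sym Hg)). }
assert (N : forall h : hom (F X) (F Y),
  h = inv (iota (F Y)) ∘ barmap (barmap h) ∘ iota (F X)).
{ intros h; pose proof (inv_iota_nat (im_inv A) h) as H.
  apply (f_equal (fun k => inv (iota (F Y)) ∘ k)) in H; unfold iota in *.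
  rewrite !comp_assoc, inv_fwd in H.
  unfold id in H; rewrite comp_idl in H; exact H. }
rewrite (N f), (N g), E; reflexivity.
Qed.

Lemma upper_star_unique (X Y : D) (r : relation X Y) (f g : hom (F Y) (F X)) :
  is_upper_star r f -> is_upper_star r g -> f = g.
Proof.
intros Hf Hg; apply (comparison_r (cluster_comparison cp X)).
exact (eq_trans (eq_sym Hf) Hg).
Qed.

End Tame.

(* Main.v *)
(** A tame relation is determined by either of its stars, and [r ↦ r_*] turns
    [•] into composition in [A], so the category laws are inherited from [A].
    For the dagger, the point is that [r†] is again tame, with the two stars of
    [r] exchanged.  Computing [j ∘ barmap r] through [r_*] and through [r^*],
    symmetry of the comparison relations and naturality of the twist give
    [cp_Y ∘ (id ⊗ r_* ) ∘ τ = cp_X ∘ (barmap r^* ⊗ id) ∘ τ], and [τ] is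
    epic. *)

From Stdlib Require Import ProofIrrelevance.
Require Import Defs.

Set Implicit Arguments.
Unset Strict Implicit.
Unset Printing Implicit Defensive.

(** * Identities, epimorphisms and tensor maps *)

Lemma id_left (C : Category) (X Y : C) (f : hom X Y) : id Y ∘ f = f.
Proof. apply comp_idl. Qed.

Lemma id_right (C : Category) (X Y : C) (f : hom X Y) : f ∘ id X = f.
Proof. apply comp_idr. Qed.

Lemma barmap_id (A : InvMonCat) (X : A) : barmap (id X) = id (bar X).
Proof. apply fmap_id. Qed.

Lemma barmap_comp (A : InvMonCat) (X Y Z : A) (g : hom Y Z) (f : hom X Y) :
  barmap (g ∘ f) = barmap g ∘ barmap f.
Proof. apply fmap_comp. Qed.

Definition epic (C : Category) (X Y : C) (e : hom X Y) : Prop :=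
  forall (Z : C) (f g : hom Y Z), f ∘ e = g ∘ e -> f = g.

Lemma epic_of_section (C : Category) (X Y : C) (e : hom X Y) (s : hom Y X) :
  e ∘ s = id Y -> epic e.
Proof.
intros H Z f g E.
rewrite <- (id_right f), <- (id_right g), <- H, !comp_assoc, E; reflexivity.
Qed.

Lemma epic_comp (C : Category) (X Y Z : C) (g : hom Y Z) (f : hom X Y) :
  epic g -> epic f -> epic (g ∘ f).
Proof.
intros Hg Hf W h k E; apply Hg, Hf.
rewrite <- !comp_assoc; exact E.
Qed.

(** Supplies the naturality of [inv (xi_iso _ _)] and [inv (iota _)], the two inverses that occur in
    [twist]. *)
Lemma inv_nat (C : Category) (X X' Y Y' : C) (i : Iso X Y) (i' : Iso X' Y')
    (f : hom X X') (g : hom Y Y') :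
  i' ∘ f = g ∘ i -> inv i' ∘ g = f ∘ inv i.
Proof.
intros H.
rewrite <- (id_right g), <- (fwd_inv i), (comp_assoc _ g), <- H.
rewrite !comp_assoc, inv_fwd, id_left; reflexivity.
Qed.

Section Tensor.

Variables (M : MonCat) (X X' X'' Y Y' Y'' : M).

Lemma tmap_compl (g : hom X' X'') (f : hom X X') :
  (g ∘ f) ⊗₁ id Y = (g ⊗₁ id Y) ∘ (f ⊗₁ id Y).
Proof. rewrite <- tmap_comp, id_left; reflexivity. Qed.

Lemma tmap_compr (g : hom Y' Y'') (f : hom Y Y') :
  id X ⊗₁ (g ∘ f) = (id X ⊗₁ g) ∘ (id X ⊗₁ f).
Proof. rewrite <- tmap_comp, id_left; reflexivity. Qed.

Lemma tmap_interchange (f : hom X X') (g : hom Y Y') :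
  (id X' ⊗₁ g) ∘ (f ⊗₁ id Y) = (f ⊗₁ id Y') ∘ (id X ⊗₁ g).
Proof. rewrite <- !tmap_comp, !id_left, !id_right; reflexivity. Qed.

End Tensor.

(** * The twist: naturality and cancellation *)

Section Twist.

Variables (A : InvMonCat) (S : InvSymmetry A).

(** Each of the three factors of [twist] is natural. The double bar on [f] arises at [xi] and is
    removed by [iota]. *)
Lemma twist_nat (X X' Y Y' : A) (f : hom X X') (g : hom Y Y') :
  twist S X' Y' ∘ barmap (barmap f ⊗₁ g) = (barmap g ⊗₁ f) ∘ twist S X Y.
Proof.
assert (Hxi : inv (xi_iso (bar X') Y') ∘ barmap (barmap f ⊗₁ g)
  = (barmap (barmap f) ⊗₁ barmap g) ∘ inv (xi_iso (bar X) Y)).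
{ apply inv_nat, xi_nat. }
assert (Hiota : inv (iota X') ∘ barmap (barmap f) = f ∘ inv (iota X)).
{ apply inv_nat, inv_iota_nat. }
unfold twist.
rewrite <- comp_assoc, Hxi, !comp_assoc, <- gamma_nat.
(* Both sides now begin with the same [gamma]; the two tensor maps after it are grouped on each side
   and compared factorwise. *)
rewrite <- (comp_assoc _ (gamma S X' (bar Y'))).
rewrite <- (comp_assoc _ (gamma S X' (bar Y')) (f ⊗₁ barmap g)).
rewrite <- !tmap_comp, Hiota, id_left, id_right; reflexivity.
Qed.

(** Each of the three factors has a section. *)
Lemma twist_epic (X Y : A) : epic (twist S X Y).
Proof.
unfold twist; apply epic_comp; [apply epic_comp|].
- exact (epic_of_section (gamma_gamma S (bar Y) X)).
- apply (@epic_of_section _ _ _ _ (iota X ⊗₁ id (bar Y))).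
  rewrite <- tmap_compl, inv_fwd; apply tmap_id.
- exact (epic_of_section (inv_fwd (xi_iso (bar X) Y))).
Qed.

End Twist.

(** * The category of tame relations *)

Section TameRelations.

Variables (A : InvMonCat) (D : Category) (F : Functor D A) (Omega : A)
  (cp : Cluster F Omega).

Lemma TameRel_ext (X Y : D) (r s : TameRel cp X Y) : rel r = rel s -> r = s.
Proof.
destruct r as [r Hr], s as [s Hs]; simpl; intros E; subst s.
f_equal; apply proof_irrelevance.
Qed.

(** The relation is recovered from its star through [cp Y]. All category and dagger laws below are
    checked along this injection. *)
Lemma lower_star_inj (X Y : D) (r s : TameRel cp X Y) :
  lower_star r = lower_star s -> r = s.
Proof.
intros E; apply TameRel_ext.
rewrite <- (lower_starP r), <- (lower_starP s), E; reflexivity.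
Qed.

(** [lower_star] is a chosen witness that does not compute; uniqueness identifies it with any
    explicit one. *)
Lemma lower_star_eq (X Y : D) (r : TameRel cp X Y) f :
  is_lower_star cp (rel r) f -> lower_star r = f.
Proof. exact (lower_star_unique (lower_starP r)). Qed.

Lemma upper_star_eq (X Y : D) (r : TameRel cp X Y) g :
  is_upper_star cp (rel r) g -> upper_star r = g.
Proof. exact (upper_star_unique (upper_starP r)). Qed.

Lemma is_lower_star_id (X : D) : is_lower_star cp (cp X) (id (F X)).
Proof.
unfold is_lower_star; rewrite barmap_id, tmap_id; apply id_right.
Qed.

Lemma is_upper_star_id (X : D) : is_upper_star cp (cp X) (id (F X)).
Proof. unfold is_upper_star; rewrite tmap_id, id_right; reflexivity. Qed.

Definition tame_id (X : D) : TameRel cp X X :=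
  {| rel := cp X;
     rel_tame := conj (ex_intro _ _ (is_lower_star_id X))
                      (ex_intro _ _ (is_upper_star_id X)) |}.

Section Composition.

Variables (X Y Z : D) (s : TameRel cp Y Z) (r : TameRel cp X Y).

Definition comp_rel : relation F Omega X Z :=
  rel s ∘ (barmap (lower_star r) ⊗₁ id (F Z)).

Lemma is_lower_star_comp :
  is_lower_star cp comp_rel (lower_star s ∘ lower_star r).
Proof.
unfold is_lower_star, comp_rel.
rewrite barmap_comp, tmap_compl, comp_assoc, (lower_starP s); reflexivity.
Qed.

(** With [r] in lower star form and [s] in upper star form, both sides apply [barmap (lower_star r)]
    and [upper_star s] to different tensor factors before [cp Y], so interchange makes them
    agree. *)
Lemma is_upper_star_comp :
  is_upper_star cp comp_rel (upper_star r ∘ upper_star s).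
Proof.
unfold is_upper_star, comp_rel.
rewrite tmap_compr, comp_assoc, <- (upper_starP r), <- (lower_starP r).
rewrite (upper_starP s), <- !comp_assoc, tmap_interchange; reflexivity.
Qed.

Definition tame_comp : TameRel cp X Z :=
  {| rel := comp_rel;
     rel_tame := conj (ex_intro _ _ is_lower_star_comp)
                      (ex_intro _ _ is_upper_star_comp) |}.

Lemma lower_star_comp :
  lower_star tame_comp = lower_star s ∘ lower_star r.
Proof. exact (lower_star_eq (r := tame_comp) is_lower_star_comp). Qed.

Lemma upper_star_comp :
  upper_star tame_comp = upper_star r ∘ upper_star s.
Proof. exact (upper_star_eq (r := tame_comp) is_upper_star_comp). Qed.

End Composition.

Lemma lower_star_id (X : D) : lower_star (tame_id X) = id (F X).
Proof. exact (lower_star_eq (r := tame_id X) (is_lower_star_id X)). Qed.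

Lemma upper_star_id (X : D) : upper_star (tame_id X) = id (F X).
Proof. exact (upper_star_eq (r := tame_id X) (is_upper_star_id X)). Qed.

(** Kept transparent, so that the prescribed formulas for identities and composites hold by
    conversion. *)
Definition TRel : CategoryOn (fun X Y : D => TameRel cp X Y).
Proof.
refine {| idm := tame_id; comp := tame_comp |}.
- intros X Y r; apply lower_star_inj.
  rewrite lower_star_comp, lower_star_id; apply id_left.
- intros X Y r; apply lower_star_inj.
  rewrite lower_star_comp, lower_star_id; apply id_right.
- intros W X Y Z t s r; apply lower_star_inj.
  rewrite !lower_star_comp; apply comp_assoc.
Defined.

(** * The dagger *)

Section TameDagger.

Variables (S : InvSymmetry A) (j : SelfConjugate (im_inv A) Omega)
  (cp_sym : symmetric_cluster S j cp).

Section DaggerRel.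

Variables (X Y : D) (r : TameRel cp X Y).

Definition dag_rel : relation F Omega Y X :=
  cp X ∘ (barmap (upper_star r) ⊗₁ id (F X)).

Lemma is_lower_star_dag : is_lower_star cp dag_rel (upper_star r).
Proof. reflexivity. Qed.

Lemma is_upper_star_dag : is_upper_star cp dag_rel (lower_star r).
Proof.
apply (@twist_epic A S (F X) (F Y)); unfold dag_rel.
(* Writing the identity as a [barmap] gives both sides the shape required by [twist_nat]; [twist]
   then meets [cp], where symmetry applies. *)
rewrite <- (barmap_id (F Y)), <- !comp_assoc, <- !twist_nat, !comp_assoc.
rewrite !cp_sym, barmap_id, <- !comp_assoc; fold (bar Omega).
rewrite <- !barmap_comp.
(* Both sides are now [j ∘ barmap (rel r)], with [rel r] expressed by its upper star on the left and
   its lower star on the right. *)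
rewrite <- (upper_starP r), (lower_starP r); reflexivity.
Qed.

Definition tame_dag : TameRel cp Y X :=
  {| rel := dag_rel;
     rel_tame := conj (ex_intro _ _ is_lower_star_dag)
                      (ex_intro _ _ is_upper_star_dag) |}.

Lemma lower_star_dag : lower_star tame_dag = upper_star r.
Proof. exact (lower_star_eq (r := tame_dag) is_lower_star_dag). Qed.

Lemma upper_star_dag : upper_star tame_dag = lower_star r.
Proof. exact (upper_star_eq (r := tame_dag) is_upper_star_dag). Qed.

End DaggerRel.

(** On lower stars the dagger reads off the upper star, which reverses composition; involutivity is
    the exchange of stars done twice. *)
Definition TRel_dagger : Dagger (Cat TRel).
Proof.
refine {| dag := tame_dag : forall X Y : Cat TRel, hom X Y -> hom Y X |}.
- intros X; apply lower_star_inj.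
  rewrite lower_star_dag; unfold id; simpl.
  rewrite upper_star_id, lower_star_id; reflexivity.
- intros X Y Z s r; apply lower_star_inj; simpl.
  rewrite lower_star_comp, !lower_star_dag; apply upper_star_comp.
- intros X Y r; apply lower_star_inj.
  rewrite lower_star_dag; apply upper_star_dag.
Defined.

End TameDagger.

End TameRelations.

Theorem proposition3p5 :
  forall (A : InvMonCat) (D : Category) (D_discrete : discrete D)
    (F : Functor D A) (Omega : A) (cp : Cluster F Omega),
  exists TRel : CategoryOn (fun X Y : D => TameRel cp X Y),
    (forall X : D, rel (idm TRel X) = cp X)
    /\ (forall (X Y Z : D) (r : TameRel cp X Y) (s : TameRel cp Y Z),
          rel (comp TRel s r)
          = rel s ∘ (barmap (lower_star r) ⊗₁ id (F Z)))
    /\ (forall (S : InvSymmetry A) (j : SelfConjugate (im_inv A) Omega),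
          symmetric_cluster S j cp ->
          exists dagger : Dagger (Cat TRel),
            forall (X Y : D) (r : TameRel cp X Y),
              rel (dagger X Y r)
              = cp X ∘ (barmap (upper_star r) ⊗₁ id (F X))).
Proof.
intros A D _ F Omega cp; exists (TRel cp); repeat split.
intros S j cp_sym; exists (TRel_dagger cp_sym); reflexivity.
Qed.
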